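(* Let $X$ be a coarsely connected proper coarse space and let $G=\mathbb{N}^k$ or $G=\mathbb{Z}^k$ with $k\ge 1$. Suppose $G$ acts on $X$ by a coarse action, and suppose that there exists a point $x_0\in X$ whose orbit is coarse. Then the induced action of $G$ on the Higson corona $\nu X$ has a fixed point: there exists $x\in\nu X$ such that $g\cdot x=x$ for every $g\in G$. Moreover, let $\overline{X}$ be a coarse compactification of $X$, and suppose in addition that the action of $G$ on $X$ is continuous and extends to a continuous action of $G$ on $\overline{X}$. Then the action on the boundary $\partial X=\overline{X}\setminus X$ has a fixed point: there exists $z\in\partial X$ such that $g\cdot z=z$ for every $g\in G$.
   Context: Coarse spaces. A coarse structure on a set $X$ is a family of subsets of $X\times X$ (the controlled sets) containing the diagonal and closed under subsets, finite unions, inverses (transposes) and compositions. A subset $B\subset X$ is bounded if $B\times B$ is controlled. $X$ is coarsely connected if $\{(x,y)\}$ is controlled for all $x,y\in X$. A proper coarse space is a paracompact Hausdorff topological space $X$ with a coarse structure such that some controlled set is a neighborhood of the diagonal and every bounded set is relatively compact. Maps. A map $f\colon X\to Y$ of coarse spaces is proper if preimages of bounded sets are bounded, bornologous if $f\times f$ sends controlled sets to controlled sets, and coarse if it is both proper and bornologous. Coarse maps need not be continuous. The group or semigroup. $\mathbb{N}=\{0,1,2,\dots\}$, and $\mathbb{N}^k$ acts as a monoid. $G$ carries the discrete topology and the coarse structure generated by the sets $\Delta_g=\{(h,hg): h\in G\}$ as $g$ runs over a finite generating set of $G$; for $G=\mathbb{N}^k,\mathbb{Z}^k$ this is the bounded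 coarse structure of the usual word ($\ell^1$) metric, and its bounded sets are the finite sets. Actions. An action of $G$ on $X$ is a coarse action if for each $g\in G$ the map $\Psi_g\colon X\to X$, $x\mapsto g\cdot x$, is a coarse map. The orbit of $x_0\in X$ is called coarse if the orbit map $\Phi_{x_0}\colon G\to X$, $g\mapsto g\cdot x_0$, is a coarse map. Higson corona. For a function $f\colon X\to\mathbb{C}$ put $\mathbf{d}f(x,y)=f(y)-f(x)$. A bounded continuous $f$ is a Higson function if for every controlled set $E$ and every $\epsilon>0$ there is a bounded set $B$ with $|\mathbf{d}f(x,y)|<\epsilon$ for all $(x,y)\in E\setminus (B\times B)$. The Higson functions form a unital $C^*$-algebra $C_h(X)$; the Higson compactification $hX$ is the compactification of $X$ with $C(hX)=C_h(X)$, and the Higson corona is $\nu X=hX\setminus X$. Equivalently, $C(\nu X)\cong C_h(X)/C_0(X)\cong B_h(X)/B_0(X)$, where $B_h(X)$ is the algebra of bounded (not necessarily continuous) functions $f\colon X\to\mathbb{C}$ such that for every controlled set $E$ and every $\epsilon>0$ there is a bounded set $B$ with $|\mathbf{d}f(x,y)|<\epsilon$ for all $(x,y)\in E\setminus (B\times B)$, and $B_0(X)$ is the ideal of those bounded functions that are smaller than $\epsilon$ in absolute value outside some bounded set, for every $\epsilon>0$. A coarse map $f\colon X\to Y$ of proper coarse spaces induces, via pullback $B_h(Y)/B_0(Y)\to B_h(X)/B_0(X)$, a continuous map ${}_\nu f\colon\nu X\to\nu Y$, functorially. The induced action of $G$ on $\nu X$ is $g\cdot x={}_\nu\Psi_g(x)$.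 Coarse compactification. A compactification $\overline{X}$ of $X$ (compact Hausdorff, containing $X$ as an open dense subspace) is a coarse compactification if for every controlled $E\subset X\times X$ the closure $\overline{E}$ in $\overline{X}\times\overline{X}$ satisfies $\overline{E}\cap\big((\overline{X}\times\overline{X})\setminus(X\times X)\big)\subset\{(\omega,\omega):\omega\in\partial X\}$, where $\partial X=\overline{X}\setminus X$. *)

(* Defs.v *)
From HB Require Import structures.
From mathcomp Require Import all_boot all_order all_algebra.
From mathcomp Require Import complex.
From mathcomp Require Import all_classical all_reals all_analysis.

Set Implicit Arguments.
Unset Strict Implicit.
Unset Printing Implicit Defensive.

Import Order.TTheory GRing.Theory Num.Theory numFieldNormedType.Exports.

Local Open Scope classical_set_scope.
Local Open Scope ring_scope.
Local Open Scope complex_scope.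

(* [R[i]], typed so that its norm topology is inferred. *)
Definition Cplx (R : realType) : numClosedFieldType := R[i].

Section CoarseStructures.

(* Finite unions are binary ones: the empty set is a subset of the diagonal.
   In MathComp-Analysis [F \; E] relates x to z when E (x, y) and F (y, z). *)
Definition coarse_structure (X : Type) (C : set (set (X * X))) : Prop :=
  [/\ C diagonal,
      forall E F, F `<=` E -> C E -> C F,
      forall E F, C E -> C F -> C (E `|` F),
      forall E, C E -> C E^-1%relation &
      forall E F, C E -> C F -> C (F \; E)%relation].

Definition coarse_bounded (X : Type) (C : set (set (X * X))) (B : set X) :
  Prop := C (B `*` B).

Definition coarsely_connected (X : Type) (C : set (set (X * X))) : Prop :=
  forall x y : X, C [set (x, y)].

Definition locally_finite (X : topologicalType) (U : set (set X)) : Prop :=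
  forall x : X, exists2 N, nbhs x N & finite_set (U `&` [set V | V `&` N !=set0]).

Definition paracompact (X : topologicalType) : Prop :=
  forall U : set (set X),
    (forall V, U V -> open V) -> \bigcup_(V in U) V = setT ->
    exists W : set (set X),
      [/\ forall V, W V -> open V,
          \bigcup_(V in W) V = setT,
          forall V, W V -> exists2 V', U V' & V `<=` V' &
          locally_finite W].

Definition proper_coarse_space (X : topologicalType)
    (C : set (set (X * X))) : Prop :=
  [/\ coarse_structure C,
      paracompact X,
      hausdorff_space X,
      exists2 E, C E & forall x : X, nbhs (x, x) E &
      forall B, coarse_bounded C B -> compact (closure B)].

Definition coarse_proper (X Y : Type) (CX : set (set (X * X)))
    (CY : set (set (Y * Y))) (f : X -> Y) : Prop :=
  forall B, coarse_bounded CY B -> coarse_bounded CX (f @^-1` B).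

Definition bornologous (X Y : Type) (CX : set (set (X * X)))
    (CY : set (set (Y * Y))) (f : X -> Y) : Prop :=
  forall E, CX E -> CY ((fun p => (f p.1, f p.2)) @` E).

Definition coarse_map (X Y : Type) (CX : set (set (X * X)))
    (CY : set (set (Y * Y))) (f : X -> Y) : Prop :=
  coarse_proper CX CY f /\ bornologous CX CY f.

End CoarseStructures.

Section Actions.

(* Translations [Delta_g] by the standard generators; any other finite
   generating set generates the same coarse structure. The row vectors over
   [nat] (resp. [int]) are the monoid N^k (resp. the group Z^k). *)
Definition lattice_coarse (A : pzSemiRingType) (k : nat) :
    set (set ('rV[A]_k * 'rV[A]_k)) :=
  smallest (@coarse_structure 'rV[A]_k)
    [set [set p | p.2 = p.1 + delta_mx 0 i] | i in [set: 'I_k]].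

Definition is_action (G : nmodType) (X : Type) (act : G -> X -> X) : Prop :=
  (forall x, act 0 x = x) /\
  (forall g h x, act (g + h) x = act g (act h x)).

Definition coarse_action (G : nmodType) (X : Type) (C : set (set (X * X)))
    (act : G -> X -> X) : Prop :=
  is_action act /\ forall g, coarse_map C C (act g).

End Actions.

Section HigsonFunctions.
Variables (R : realType) (X : Type) (C : set (set (X * X))).

Definition bounded_function (f : X -> Cplx R) : Prop :=
  exists M : R, forall x, `|f x| <= M%:C.

(* [B_h(X)] *)
Definition vanishing_variation (f : X -> Cplx R) : Prop :=
  bounded_function f /\
  forall E, C E -> forall e : R, 0 < e ->
    exists2 B, coarse_bounded C B &
      forall x y, (E `\` (B `*` B)) (x, y) -> `|f y - f x| < e%:C.

(* [B_0(X)] *)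
Definition vanishing_at_infinity (f : X -> Cplx R) : Prop :=
  bounded_function f /\
  forall e : R, 0 < e ->
    exists2 B, coarse_bounded C B & forall x, ~ B x -> `|f x| < e%:C.

End HigsonFunctions.

(* [C_h(X)] *)
Definition higson_function (R : realType) (X : topologicalType)
    (C : set (set (X * X))) (f : X -> Cplx R) : Prop :=
  continuous f /\ vanishing_variation C f.

Section Compactifications.

(* [iota] identifies X with an open dense subspace of K. *)
Definition compactification (X K : topologicalType) (iota : X -> K) : Prop :=
  [/\ compact [set: K] /\ hausdorff_space K,
      injective iota,
      forall A : set X, open A <-> exists2 O, open O & iota @^-1` O = A,
      open (range iota) &
      dense (range iota)].

Definition boundary (X K : Type) (iota : X -> K) : set K := ~` range iota.

Definition coarse_compactification (X K : topologicalType)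
    (C : set (set (X * X))) (iota : X -> K) : Prop :=
  compactification iota /\
  forall E, C E ->
    closure ((fun p => (iota p.1, iota p.2)) @` E)
      `&` ~` (range iota `*` range iota)
    `<=` [set (w, w) | w in boundary iota].

(* The compactification with [C(hX) = C_h(X)]; the Higson corona is
   [boundary iota]. *)
Definition higson_compactification (R : realType) (X hX : topologicalType)
    (C : set (set (X * X))) (iota : X -> hX) : Prop :=
  compactification iota /\
  forall f : X -> Cplx R,
    higson_function C f <->
    exists2 u : hX -> Cplx R, continuous u & u \o iota = f.

(* Under [C(nu X) = C_h(X)/C_0(X) = B_h(X)/B_0(X)], the continuous function on
   the corona given by the class of [phi] in [B_h(X)] takes the value [c] at
   [x]. *)
Definition corona_value (R : realType) (X hX : topologicalType)
    (C : set (set (X * X))) (iota : X -> hX) (phi : X -> Cplx R) (x : hX)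
    (c : Cplx R) : Prop :=
  exists u : hX -> Cplx R,
    [/\ continuous u,
        vanishing_at_infinity C (fun p => u (iota p) - phi p) &
        u x = c].

(* [y] is the image of [x] under the map [nu X -> nu Y] dual to the pullback
   [B_h(Y)/B_0(Y) -> B_h(X)/B_0(X)] along the coarse map [f]: each class
   takes at [y] the value that its pullback takes at [x]. *)
Definition corona_image (R : realType) (X Y hX hY : topologicalType)
    (CX : set (set (X * X))) (CY : set (set (Y * Y)))
    (iX : X -> hX) (iY : Y -> hY) (f : X -> Y) (x : hX) (y : hY) : Prop :=
  [/\ boundary iX x,
      boundary iY y &
      forall phi : Y -> Cplx R, vanishing_variation CY phi ->
        exists2 c, corona_value CY iY phi y c
                 & corona_value CX iX (phi \o f) x c].

End Compactifications.

(* Main.v *)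
(* As G is commutative, g . (h . x0) = (h + g) . x0, so the orbit map sends
   (h, h + g) to (y, g . y) with y = h . x0; hence on the orbit each g is at
   controlled distance from the identity. The orbit map is proper, so
   s n = (n e_0) . x0 leaves every bounded set, and every cluster point z of s
   in a compactification lies in the boundary. In a coarse compactification,
   (z, g . z) is then in the closure of a controlled set, so g . z = z. For the
   Higson corona, each class in B_h/B_0 has a continuous representative (average
   it with a partition of unity subordinate to a controlled cover), and the
   extensions of the representatives of phi and phi o g to hX differ along s by
   a sequence tending to 0, so they agree at z. *)
Require Import Defs.
From HB Require Import structures.
From mathcomp Require Import all_boot all_order all_algebra.
From mathcomp Require Import complex finmap ring zify.
From mathcomp Require Import all_classical all_reals all_analysis.

Set Implicit Arguments.
Unset Strict Implicit.
Unset Printing Implicit Defensive.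

Import Order.TTheory GRing.Theory Num.Theory numFieldNormedType.Exports.

Local Open Scope classical_set_scope.
Local Open Scope ring_scope.
Local Open Scope complex_scope.

(** * Locally finite families of bump functions *)

(* The filter of all supersets of some finite set turns the local finiteness
   at each point of K into a near covering of K. *)
Lemma locally_finite_compact (X : topologicalType) (U : set (set X))
    (K : set X) : locally_finite U -> compact K ->
  finite_set (U `&` [set V | V `&` K !=set0]).
Proof.
move=> Ufin /compact_near_coveringP cptK.
pose F := filter_from [set D : set (set X) | finite_set D]
  (fun D => [set D' | D `<=` D']).
have FF : Filter F.
  apply: filter_from_filter => [|D1 D2 finD1 finD2].
    by exists set0; exact: finite_set0.
  exists (D1 `|` D2); first by rewrite /= finite_setU; split.
  by move=> D' sD'; split=> V DV; apply: sD'; [left|right].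
have [x Kx|D finD sD] := cptK _ F (fun D x => forall V, U V -> V x -> D V) FF.
  have [N xN finN] := Ufin x.
  exists (N, [set D | U `&` [set V | V `&` N !=set0] `<=` D]).
    by split=> //; exists (U `&` [set V | V `&` N !=set0]).
  by move=> -[y D] /= [Ny sD] V UV Vy; apply: sD; split=> //; exists y.
apply: sub_finite_set finD => V [UV [x [Vx Kx]]].
exact: (sD D (@subset_refl _ D) x).
Qed.

Lemma completely_regular_bump (R : realType) (X : topologicalType) :
  completely_regular_space X -> forall (x : X) (V : set X), open V -> V x ->
  exists h : X -> R, [/\ continuous h, forall y, 0 <= h y, 0 < h x &
    forall y, h y != 0 -> V y].
Proof.
move=> crX x V oV Vx.
have /(@uniform_separatorP X R)[h [hC h01 h0 h1]] :
    uniform_separator [set x] (~` V).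
  by apply: crX; [exact: open_closedC|exact].
exists (fun y => 1 - h y); split.
- by move=> y; apply: cvgB; [exact: cvg_cst|exact: hC].
- move=> y; have : h y \in `[0, 1] by apply: h01; exists y.
  by rewrite in_itv /= subr_ge0 => /andP[].
- by have -> : h x = 0; [apply: h0; exists x|rewrite subr0].
- move=> y; apply: contra_neqP => nVy.
  by have -> : h y = 1; [apply: h1; exists y|rewrite subrr].
Qed.

(** A partition of unity subordinate to [O], up to division by the sum. The index type is all of
    [set X], with [h i] zero unless [i] is a nonempty member of the refined cover. *)
Lemma bump_family (R : realType) (X : topologicalType)
    (O : X -> set X) (x0 : X) :
  paracompact X -> completely_regular_space X -> locally_compact [set: X] ->
  (forall x, nbhs x (O x)) ->
  exists (h : set X -> X -> R) (p : set X -> X),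
    [/\ forall i, continuous (h i),
        forall i x, 0 <= h i x,
        forall x, exists i, 0 < h i x,
        forall i x, h i x != 0 -> O (p i) x &
        forall x : X, exists2 N, nbhs x N &
          finite_set [set i | exists2 y, N y & h i y != 0]].
Proof.
move=> pcX crX lcX nbO.
have /choice[B BP] : forall x, exists V,
    [/\ open V, V x, V `<=` O x & compact (closure V)].
  move=> x; have [C] := lcX x I; rewrite withinET => xC [cC clC].
  have [V [oV Vx] sV] : exists2 V, open_nbhs x V & V `<=` C `&` O x.
    have : nbhs x (C `&` O x) by exact: filterI.
    by rewrite nbhsE => -[V]; exists V.
  exists V; split=> //; first by move=> y /sV [].
  apply: (subclosed_compact _ cC); first exact: closed_closure.
  by rewrite (closure_id C).1 //; apply: closureS => y /sV [].
have [||W1 [oW1 cW1 rW1 lfW1]] := pcX (range B).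
- by move=> _ [x _ <-]; have [] := BP x.
- by apply/seteqP; split=> // x _; exists (B x); [exists x|have [] := BP x].
(* Each x gets a bump g x supported in a member V x of W1, and W2 refines the
   cover by the sets where the g x are positive. A member of W1 is relatively
   compact, so it meets finitely many members of W2: the bumps g (q W), W in W2,
   are locally finite. *)
have /choice[V VP] : forall x, exists V, W1 V /\ V x.
  move=> x; have : (\bigcup_(V in W1) V) x by rewrite cW1.
  by move=> [V ? ?]; exists V.
have /choice[c cP] : forall x, exists y, V x `<=` B y.
  by move=> x; have [_ [y _ <-] ?] := rW1 _ (VP x).1; exists y.
have /choice[g gP] : forall x, exists g : X -> R,
    [/\ continuous g, forall y, 0 <= g y, 0 < g x & forall y, g y != 0 -> V x y].
  move=> x; have [W1V Vx] := VP x.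
  exact: completely_regular_bump (oW1 _ W1V) Vx.
pose pos (f : X -> R) := [set y | 0 < f y].
have [||W2 [oW2 cW2 rW2 lfW2]] := pcX (range (pos \o g)).
- move=> _ [x _ <-] /=; have [gC _ _ _] := gP x.
  by apply: (open_comp _ (@open_gt R 0)) => y _; exact: gC.
- by apply/seteqP; split=> // x _; exists (pos (g x)); [exists x|have [] := gP x].
(* [x0] is the default value of [q] outside [W2]. *)
have /choice[q qP] : forall W, exists x, W2 W -> W `<=` pos (g x).
  move=> W; have [W2W|nW2W] := pselect (W2 W); last by exists x0.
  by have [_ [x _ <-] ?] := rW2 W W2W; exists x.
(* Each index [W] has a point [w]; as [g (q W) w] is positive, [w] lies in [V (q W)], so [W] meets
   that member of [W1]. *)
pose I := [set W | W2 W /\ W !=set0].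
exists (fun W => if W \in I then g (q W) else fun=> 0), (c \o q); split.
- move=> W; case: ifP => _; last by move=> x; exact: cvg_cst.
  by have [] := gP (q W).
- by move=> W x; case: ifP => // _; have [] := gP (q W).
- move=> x; have : (\bigcup_(V in W2) V) x by rewrite cW2.
  move=> [W W2W Wx]; exists W; rewrite ifT; first exact: (qP W W2W).
  by rewrite inE; split=> //; exists x.
- move=> W x /=; case: ifP => _; last by rewrite eqxx.
  have [_ _ _ /(_ x) gV] := gP (q W).
  by move=> /gV /cP; have [_ _ + _] := BP (c (q W)); exact.
- move=> x; have [N xN finN] := lfW1 x; exists N => //.
  apply: (@sub_finite_set _ _ (\bigcup_(V' in W1 `&` [set V' | V' `&` N !=set0])
      (W2 `&` [set W | W `&` closure V' !=set0]))).
    move=> W [y Ny]; case: ifP => [|_]; last by rewrite eqxx.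
    rewrite inE => -[W2W [w Ww]] gy.
    have [_ _ _ gV] := gP (q W).
    exists (V (q W)).
      by split; [exact: (VP (q W)).1|exists y; split=> //; exact: gV].
    split=> //; exists w; split=> //; apply/subset_closure/gV.
    by rewrite gt_eqF //; exact: (qP W W2W).
  apply: bigcup_finite => // V' [W1V' _].
  apply: locally_finite_compact => //.
  have [_ [y _ <-] sV'] := rW1 _ W1V'; have [_ _ _ cy] := BP y.
  by apply: (subclosed_compact _ cy); [exact: closed_closure|exact: closureS].
Qed.

(** * Continuous approximation by weighted means *)

Lemma normc_real (R : realType) (x : R) : `|x%:C : Cplx R| = `|x|%:C.
Proof. by rewrite normc_def /= expr0n addr0 sqrtr_sqr. Qed.

Lemma gt0_Cplx (R : realType) (e : Cplx R) : 0 < e ->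
  exists2 r : R, 0 < r & e = r%:C.
Proof.
by case: e => a b; rewrite ltcE /= => /andP[/eqP -> a0]; exists a.
Qed.

Lemma continuous_real_complex (R : realType) :
  continuous (fun x : R => x%:C : Cplx R).
Proof.
move=> x; apply/cvgrPdist_lt => _ /gt0_Cplx[e e0 ->].
have /cvgrPdist_lt/(_ _ e0) : y @[y --> x] --> x by exact: cvg_id.
by apply: filterS => y; rewrite -rmorphB normc_real ltcR.
Qed.

(** A sum over [[set: I]] is 0 by convention if its support is infinite. Local finiteness excludes
    this and makes it, near each point, a sum over one fixed finite set. *)
Lemma continuous_locally_finite_sum (K : numFieldType) (X : topologicalType)
    (I : choiceType) (f : I -> X -> K) :
  (forall i, continuous (f i)) ->
  (forall x : X, exists2 N, nbhs x N &
    finite_set [set i | exists2 y, N y & f i y != 0]) ->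
  continuous (fun x => \sum_(i \in [set: I]) f i x).
Proof.
move=> fC lff x; have [N xN finN] := lff x.
set D := [set i | _] in finN.
have sumE y : N y -> \sum_(i <- fset_set D) f i y = \sum_(i \in setT) f i y.
  move=> Ny; rewrite -fsbigTE // => i.
  rewrite in_fset_set // notin_setE => nDi; apply/eqP/negPn/negP => fiy.
  by apply: nDi; exists y.
rewrite /continuous_at -sumE; last exact: nbhs_singleton.
have sumC : \sum_(i <- fset_set D) f i y @[y --> x] -->
    \sum_(i <- fset_set D) f i x.
  by apply: cvg_big => [|i _]; [exact: add_continuous|exact: fC].
apply: cvg_trans sumC.
by apply: near_eq_cvg; apply: filterS xN.
Qed.

(** [f x] is the mean of the values [phi (p i)] with weights [h i x]. Only indices with [O (p i) x]
    have nonzero weight at [x], so a bound on the distance from these values to [phi x] passes to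
    the mean. *)
Lemma continuous_approximation (R : realType) (X : topologicalType)
    (O : X -> set X) (phi : X -> Cplx R) :
  paracompact X -> completely_regular_space X -> locally_compact [set: X] ->
  (forall x, nbhs x (O x)) ->
  exists2 f : X -> Cplx R, continuous f & forall x (c : Cplx R),
    (forall p, O p x -> `|phi p - phi x| <= c) -> `|f x - phi x| <= c.
Proof.
move=> pcX crX lcX nbO.
have [[x0]|noX] := pselect (exists x : X, True); last first.
  by exists phi => x; case: noX; exists x.
have [h [p [hC h0 hpos hO hfin]]] := bump_family R x0 pcX crX lcX nbO.
pose w i x : Cplx R := (h i x)%:C.
have wC i : continuous (w i).
  by move=> x; apply: continuous_comp; [exact: hC|exact: continuous_real_complex].
have w_eq0 i x : (w i x == 0) = (h i x == 0).
  by rewrite /w eq_complex /= eqxx andbT.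
have w_ge0 i x : 0 <= w i x by rewrite ler0c.
pose S x := \sum_(i \in setT) w i x.
pose T x := \sum_(i \in setT) w i x * phi (p i).
have fin x : exists D : {fset set X}, [/\ S x = \sum_(i <- D) w i x,
    T x = \sum_(i <- D) w i x * phi (p i) & forall i, h i x != 0 -> i \in D].
  have [N xN finN] := hfin x; set D := [set i | _] in finN.
  have inD i : h i x != 0 -> i \in fset_set D.
    move=> hix; rewrite in_fset_set // inE; exists x => //.
    exact: nbhs_singleton.
  exists (fset_set D); split=> //; apply: fsbigTE => i; apply: contraNeq.
    by rewrite w_eq0; exact: inD.
  by rewrite mulf_eq0 negb_or w_eq0 => /andP[+ _]; exact: inD.
have S_gt0 x : 0 < S x.
  have [D [-> _ inD]] := fin x; have [i hi] := hpos x.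
  have iD : i \in D by apply: inD; rewrite gt_eqF.
  by rewrite (big_fsetD1 i) //= ltr_pwDl ?ltcR // sumr_ge0.
exists (fun x => T x / S x) => [x|x c phic].
  apply: cvgM; last first.
    apply: cvgV; first by rewrite gt_eqF.
    apply: continuous_locally_finite_sum => // y.
    have [N yN finN] := hfin y; exists N => //; apply: sub_finite_set finN.
    by move=> i [z Nz]; rewrite w_eq0; exists z.
  apply: continuous_locally_finite_sum => [i y|y].
    by apply: cvgM; [exact: wC|exact: cvg_cst].
  have [N yN finN] := hfin y; exists N => //; apply: sub_finite_set finN.
  by move=> i [z Nz]; rewrite mulf_eq0 negb_or w_eq0 => /andP[? _]; exists z.
have Sx0 := S_gt0 x; have [D [SE TE _]] := fin x.
(* With [phi x] written as [phi x * S x / S x], the error is the sum of the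
   [w i x * (phi (p i) - phi x)] divided by [S x]. *)
rewrite -(mulfK (lt0r_neq0 Sx0) (phi x)) -mulrBl normrM normfV (gtr0_norm Sx0).
rewrite ler_pdivrMr // TE SE !mulr_sumr -sumrB.
apply: le_trans (ler_norm_sum _ _ _) _; apply: ler_sum => i _.
rewrite [phi x * _]mulrC -mulrBr normrM ger0_norm // [c * _]mulrC.
have [->|hix] := eqVneq (w i x) 0; first by rewrite !mul0r.
by apply: ler_wpM2l => //; apply: phic; apply: hO; rewrite -w_eq0.
Qed.

(** * Coarse spaces and continuous representatives of classes in [B_h/B_0] *)

Lemma ltr_normD3 (R : realType) (a b c : Cplx R) (e : R) :
  `|a| < (e / 3)%:C -> `|b| < (e / 3)%:C -> `|c| < (e / 3)%:C ->
  `|a + b + c| < e%:C.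
Proof.
move=> ae be ce; have -> : e = e / 3 + e / 3 + e / 3 by field.
rewrite !rmorphD (le_lt_trans (ler_normD _ _)) // ltrD //.
by rewrite (le_lt_trans (ler_normD _ _)) // ltrD.
Qed.

Lemma nbhs_section (X : topologicalType) (E : set (X * X)) (x : X) :
  nbhs (x, x) E -> nbhs x [set y | E (x, y)].
Proof.
move=> [[A B] /= [xA xB] AB]; apply: filterS xB => y By; apply: AB.
by split=> //; exact: nbhs_singleton.
Qed.

Lemma coarse_bounded_section (X : Type) (C : set (set (X * X)))
    (E : set (X * X)) (p : X) : coarse_structure C -> C E ->
  coarse_bounded C [set y | E (p, y)].
Proof.
move=> [_ sub _ inv comp] CE.
by apply: sub (comp _ _ (inv _ CE) CE) => -[y z] [/= Ey Ez]; exists p.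
Qed.

(** Coarse connectedness lets a pair from [A] to [B] factor through a pair in [A], the single pair
    [(a, b)] and a pair in [B]. *)
Lemma coarse_boundedU (X : Type) (C : set (set (X * X))) (A B : set X) :
  coarse_structure C -> coarsely_connected C ->
  coarse_bounded C A -> coarse_bounded C B -> coarse_bounded C (A `|` B).
Proof.
move=> [diag sub union inv comp] conn CA CB; rewrite /coarse_bounded.
have [->|/set0P[a Aa]] := eqVneq A set0; first by rewrite set0U.
have [->|/set0P[b Bb]] := eqVneq B set0; first by rewrite setU0.
have CAB : C (A `*` B).
  apply: sub (comp _ _ (comp _ _ CA (conn a b)) CB) => -[x y] [/= Ax By].
  by exists b => //; exists a.
apply: sub (union _ _ (union _ _ CA CB) (union _ _ CAB (inv _ CAB))).
move=> [x y] [/= [Ax|Bx] [Ay|By]].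
- by left; left.
- by right; left.
- by right; right.
- by left; right.
Qed.

(** A section of the controlled neighbourhood of the diagonal is a bounded neighbourhood, so its
    closure is compact. *)
Lemma proper_coarse_locally_compact (X : topologicalType)
    (C : set (set (X * X))) : proper_coarse_space C -> locally_compact [set: X].
Proof.
move=> [CS _ _ [E CE nbE] cpt] x _; rewrite withinET.
exists (closure [set y | E (x, y)]).
  by apply: filterS (@subset_closure _ _) _; exact: nbhs_section (nbE x).
split; last exact: closed_closure.
by apply: cpt; exact: coarse_bounded_section.
Qed.

Lemma vanishing_variation_comp (R : realType) (X Y : Type)
    (CX : set (set (X * X))) (CY : set (set (Y * Y))) (f : X -> Y)
    (phi : Y -> Cplx R) : coarse_map CX CY f ->
  vanishing_variation CY phi -> vanishing_variation CX (phi \o f).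
Proof.
move=> [fprop fborn] [[M phiM] vphi].
split; first by exists M => x; exact: phiM.
move=> E CE e e0; have [B CB phiB] := vphi _ (fborn _ CE) e e0.
exists (f @^-1` B); first exact: fprop.
move=> x y [Exy nB]; apply: phiB; split; first by exists (x, y).
by move=> [? ?]; apply: nB.
Qed.

(** This is the surjectivity of [C_h/C_0 -> B_h/B_0]. Averaging over sections of a controlled
    neighbourhood [E] of the diagonal, the error at [x] is at most the variation of [phi] over pairs
    [(p, x)] in [E], which is small for [x] outside a bounded set. *)
Lemma higson_approximation (R : realType) (X : topologicalType)
    (C : set (set (X * X))) (phi : X -> Cplx R) :
  proper_coarse_space C -> coarsely_connected C -> vanishing_variation C phi ->
  exists2 f, higson_function C f &
    vanishing_at_infinity C (fun x => f x - phi x).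
Proof.
move=> Cproper conn [[M phiM] vphi].
have lcX := proper_coarse_locally_compact Cproper.
have [CS pcX hdX [E CE nbE] _] := Cproper.
have crX := @locally_compact_completely_regular X R lcX hdX.
have nbO x : nbhs x [set y | E (x, y)] by exact: nbhs_section (nbE x).
have [f fC fphi] := continuous_approximation phi pcX crX lcX nbO.
have fphi0 : vanishing_at_infinity C (fun x => f x - phi x).
  split=> [|e e0].
    exists (M + M) => x; apply: fphi => p _.
    by rewrite rmorphD (le_trans (ler_normB _ _)) // lerD.
  have e2 : 0 < e / 2 by rewrite divr_gt0.
  have [B CB phiB] := vphi _ CE _ e2.
  (* The averaging bound is not strict, hence the passage through [e / 2]. *)
  exists B => // x nBx; apply: (@le_lt_trans _ _ (e / 2)%:C); last first.
    by rewrite ltcR ltr_pdivrMr // ltr_pMr // ltr1n.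
  apply: fphi => p Epx; rewrite distrC; apply/ltW/phiB.
  by split=> // -[_ /nBx].
exists f => //; split => //; have [[M' fM] f0] := fphi0; split.
  exists (M' + M) => x; rewrite -(subrK (phi x) (f x)) rmorphD.
  by rewrite (le_trans (ler_normD _ _)) // lerD.
move=> F CF e e0; have e3 : 0 < e / 3 by rewrite divr_gt0.
have [B1 CB1 fB1] := f0 _ e3; have [B2 CB2 phiB2] := vphi _ CF _ e3.
case: (CS) => diag sub union inv comp.
(* B3 keeps both ends of a pair of F out of B1 once one of them is out of the
   union of the three sets. *)
pose B3 := [set y | exists2 b, B1 b & F (b, y) \/ F (y, b)].
have CB3 : coarse_bounded C B3.
  have CFF := union _ _ CF (inv _ CF).
  apply: sub (comp _ _ (comp _ _ CFF CB1) CFF) => -[y z] [/=].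
  move=> [a B1a Fa] [b B1b Fb]; exists b; last by case: Fb; [left|right].
  by exists a => //; case: Fa; [right|left].
have CB : coarse_bounded C (B1 `|` B2 `|` B3) by do 2?apply: coarse_boundedU.
exists (B1 `|` B2 `|` B3) => // x y [Fxy nB].
have nB1x : ~ B1 x.
  by move=> B1x; apply: nB; split; [left; left|right; exists x => //; left].
have nB1y : ~ B1 y.
  by move=> B1y; apply: nB; split; [right; exists y => //; right|left; left].
have -> : f y - f x = (f y - phi y) + (phi y - phi x) + (phi x - f x) by ring.
apply: ltr_normD3; [exact: fB1| |by rewrite distrC; exact: fB1].
by apply: phiB2; split=> // -[B2x B2y]; apply: nB; split; left; right.
Qed.

(** * Cluster points in a compactification *)

(** Cluster points stand in for limits, since a compactification need not be sequentially compact.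
    If [w z] were nonzero, [w] would stay away from 0 near [z], where [s] returns infinitely
    often. *)
Lemma cluster_eq0 (R : realType) (K : topologicalType) (s : nat -> K) (z : K)
    (w : K -> Cplx R) :
  continuous w -> cluster (s @ \oo) z ->
  (forall e : R, 0 < e -> \forall n \near \oo, `|w (s n)| < e%:C) -> w z = 0.
Proof.
move=> wC sz w0; apply/eqP; rewrite -normr_eq0.
apply: contrapT => /negP nwz.
have : 0 < `|w z| / 2 by rewrite divr_gt0 // lt_def nwz normr_ge0.
move=> /[dup] wz2 /gt0_Cplx[e e0 wze].
have /cvgrPdist_lt/(_ _ wz2) near_z := wC z.
have [y [/= wy wzy]] := sz [set y | `|w y| < e%:C] _ (w0 _ e0) near_z.
have : `|w z| < `|w z|.
  rewrite -{1}(subrK (w y) (w z)) (le_lt_trans (ler_normD _ _)) //.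
  by rewrite [ltRHS](splitr `|w z|) ltrD // wze.
by rewrite ltxx.
Qed.

(** Compactness gives a cluster point. It is not in [X], since each point of [X] has a bounded
    neighbourhood, which [s] eventually leaves. *)
Lemma escaping_cluster_boundary (X K : topologicalType)
    (C : set (set (X * X))) (iota : X -> K) (s : nat -> X) :
  proper_coarse_space C -> compactification iota ->
  (forall B, coarse_bounded C B -> \forall n \near \oo, ~ B (s n)) ->
  exists2 z, boundary iota z & cluster (iota (s n) @[n --> \oo]) z.
Proof.
move=> [CS _ _ [E CE nbE] _] [[cK _] _ oiota orng _] esc.
have [|z [_ sz]] := cK (iota (s n) @[n --> \oo]) _; first exact: filterT.
exists z => // -[p _ pz]; rewrite -{z}pz in sz.
have : nbhs p [set y | E (p, y)] by exact: nbhs_section (nbE p).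
rewrite nbhsE => -[V [oV Vp] sV].
have [W oW OV] := (oiota V).1 oV.
have Wp : nbhs (iota p) W by apply: open_nbhs_nbhs; split=> //; rewrite -OV in Vp.
have nV : \forall n \near \oo, ~ V (s n).
  apply: filterS (esc _ (coarse_bounded_section p CS CE)) => n nE /sV.
  exact: nE.
have [|y [nWy Wy]] := sz (~` W) W _ Wp; last exact: nWy.
by apply: filterS nV => n; rewrite -OV.
Qed.

Lemma corona_image_fixed (R : realType) (X hX : topologicalType)
    (C : set (set (X * X))) (iota : X -> hX) (f : X -> X) (s : nat -> X)
    (z : hX) :
  proper_coarse_space C -> coarsely_connected C ->
  higson_compactification R C iota -> coarse_map C C f ->
  (forall B, coarse_bounded C B -> \forall n \near \oo, ~ B (s n)) ->
  C [set (s n, f (s n)) | n in setT] ->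
  boundary iota z -> cluster (iota (s n) @[n --> \oo]) z ->
  corona_image R C C iota iota f z z.
Proof.
move=> Cproper conn [_ extend] fcoarse esc Csf bz sz; split=> // phi vphi.
have [u1 u1C u1phi] : exists2 u, continuous u &
    vanishing_at_infinity C (fun p => u (iota p) - phi p).
  have [g /extend[u uC <-] g0] := higson_approximation Cproper conn vphi.
  by exists u.
have vphif := vanishing_variation_comp fcoarse vphi.
have [u2 u2C u2phi] : exists2 u, continuous u &
    vanishing_at_infinity C (fun p => u (iota p) - (phi \o f) p).
  have [g /extend[u uC <-] g0] := higson_approximation Cproper conn vphif.
  by exists u.
(* [u1] and [u2] extend representatives of the classes of [phi] and [phi \o f], so their values at
   [z] are the two values to compare. *)
suff u12 : u1 z - u2 z = 0.
  exists (u1 z); first by exists u1; split; [exact: u1C|exact: u1phi|].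
  exists u2; split; [exact: u2C|exact: u2phi|].
  by apply/esym/eqP; rewrite -subr_eq0 u12.
have wC : continuous (fun y => u1 y - u2 y).
  by move=> y; apply: cvgB; [exact: u1C|exact: u2C].
apply: (cluster_eq0 wC sz) => e e0; have e3 : 0 < e / 3 by rewrite divr_gt0.
have [B1 /esc nB1 u1B] := u1phi.2 _ e3.
have [B2 /esc nB2 u2B] := u2phi.2 _ e3.
have [B3 /esc nB3 phiB] := vphi.2 _ Csf _ e3.
near=> n.
have -> : u1 (iota (s n)) - u2 (iota (s n)) = (u1 (iota (s n)) - phi (s n)) +
    (phi (s n) - phi (f (s n))) + (phi (f (s n)) - u2 (iota (s n))) by ring.
apply: ltr_normD3.
- by apply: u1B; near: n.
- rewrite distrC; apply: phiB; split; first by exists n.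
  by move=> [Bsn _]; move: Bsn; near: n.
- by rewrite distrC; apply: u2B; near: n.
Unshelve. all: by end_near. Qed.

(** If [A] and [B] are neighbourhoods of [z] and [F z], then [s] meets the intersection of [A] with
    the preimage of [B]. This puts [(z, F z)] in the closure of the controlled set of pairs
    [(s n, f (s n))]. *)
Lemma coarse_boundary_fixed (X K : topologicalType) (C : set (set (X * X)))
    (iota : X -> K) (f : X -> X) (F : K -> K) (s : nat -> X) (z : K) :
  coarse_compactification C iota -> continuous F ->
  (forall x, F (iota x) = iota (f x)) ->
  C [set (s n, f (s n)) | n in setT] ->
  boundary iota z -> cluster (iota (s n) @[n --> \oo]) z -> F z = z.
Proof.
move=> [_ CK] FC Fiota Csf bz sz.
have [] : [set (w, w) | w in boundary iota] (z, F z).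
  apply: (CK _ Csf); split; last by move=> [].
  move=> N [[A B] /= [zA FzB]] AB.
  have zAB : nbhs z (A `&` F @^-1` B) by apply: filterI => //; exact: FC.
  have [|y [[n _ <-] [An Bn]]] := sz (range (iota \o s)) _ _ zAB.
    by exists 0%N => // n _; exists n.
  exists (iota (s n), iota (f (s n))); split.
    by exists (s n, f (s n)) => //; exists n.
  by apply: AB; split=> //=; rewrite -Fiota.
by move=> w _ [<- <-].
Qed.

(** * The coarse structure of N^k and Z^k *)

Lemma smallest_coarse_structure (X : Type) (G : set (set (X * X))) :
  coarse_structure (smallest (@coarse_structure X) G).
Proof.
split=> [C [[]]//|E F FE CE C [CS sG]|E F CE CF C [CS sG]|E CE C [CS sG]|
         E F CE CF C [CS sG]]; case: (CS) => diag sub union inv comp.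
- by apply: sub FE _; exact: CE.
- by apply: union; [exact: CE|exact: CF].
- by apply: inv; exact: CE.
- by apply: comp; [exact: CE|exact: CF].
Qed.

(** Composing translations adds them, so the controlled ones form a submonoid containing the basis
    vectors. Over [int], inverse relations supply the negatives. *)
Lemma lattice_translation (A : pzSemiRingType) (k : nat)
    (A_nat_or_int : A = nat :> pzSemiRingType \/ A = int :> pzSemiRingType)
    (g : 'rV[A]_k) :
  @lattice_coarse A k [set p | p.2 = p.1 + g].
Proof.
pose T (g : 'rV[A]_k) := @lattice_coarse A k [set p | p.2 = p.1 + g].
have [diag sub union inv comp] :=
  smallest_coarse_structure [set [set p : 'rV[A]_k * 'rV[A]_k |
    p.2 = p.1 + delta_mx 0 i] | i in [set: 'I_k]].
have T0 : T 0 by apply: sub diag => -[x y] /=; rewrite addr0.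
have TD a b : T a -> T b -> T (a + b).
  move=> Ta Tb; apply: sub (comp _ _ Ta Tb) => -[x y] /= ->.
  by exists (x + a) => //=; rewrite addrA.
have T1 i : T (delta_mx 0 i) by apply: sub_gen_smallest; exists i.
rewrite -/(T g) [g]row_sum_delta; apply: big_ind => // i _.
pose Q c := T (c *: delta_mx 0 i).
have Q0 : Q 0 by rewrite /Q scale0r.
have Q1 : Q 1 by rewrite /Q scale1r.
have QD a b : Q a -> Q b -> Q (a + b) by rewrite /Q scalerDl; exact: TD.
rewrite -/(Q _); move: (g 0 i); case: A_nat_or_int => AE; subst A.
  by elim=> [//|n IHn]; rewrite -addn1; exact: QD.
have QN1 : Q (- 1).
  apply: sub (inv _ (T1 i)) => -[x y] /= ->.
  by rewrite scaleN1r subrK.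
elim=> [//|n IHn|n IHn]; first by rewrite intS; exact: QD.
by rewrite intS opprD; exact: QD.
Qed.

(** The relations with such a bound [M] form a coarse structure containing the generators, hence the
    smallest one. The map [v] into [int] treats N and Z together. *)
Lemma additive_coordinate_controlled (A : pzSemiRingType) (k : nat) (i : 'I_k)
    (v : A -> int) (E : set ('rV[A]_k * 'rV[A]_k)) :
  (forall a b, v (a + b) = v a + v b) -> @lattice_coarse A k E ->
  exists M : int, forall p, E p -> `|v (p.2 0 i) - v (p.1 0 i)| <= M.
Proof.
move=> vD; move: E; apply: smallest_sub => [|_ [j _ <-]]; last first.
  exists `|v ((delta_mx 0 j : 'rV[A]_k) 0 i)| => -[x y] /= ->.
  by rewrite mxE vD addrAC subrr add0r.
split.
- by exists 0 => -[x y] /diagonalP ->; rewrite subrr.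
- by move=> E F FE [M EM]; exists M => p /FE /EM.
- move=> E F [M EM] [N FN]; exists (Num.max M N) => p [/EM|/FN] pM.
    by rewrite le_max pM.
  by rewrite le_max pM orbT.
- by move=> E [M EM]; exists M => -[x y] /EM /=; rewrite distrC.
- move=> E F [M EM] [N FN]; exists (N + M) => -[x z] [y /= /EM xy /FN yz].
  by rewrite (le_trans (ler_distD (v (y 0 i)) _ _)) // lerD.
Qed.

Lemma lattice_line_escapes (A : pzSemiRingType) (k : nat) (i : 'I_k)
    (A_nat_or_int : A = nat :> pzSemiRingType \/ A = int :> pzSemiRingType)
    (B : set 'rV[A]_k) :
  coarse_bounded (@lattice_coarse A k) B ->
  \forall n \near \oo, ~ B (delta_mx 0 i *+ n).
Proof.
move=> CB.
have [v vD vn] : exists2 v : A -> int, forall a b, v (a + b) = v a + v b &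
    forall n, v (1 *+ n) = n.
  case: A_nat_or_int => AE {CB B}; subst A.
    by exists Posz => // n; rewrite natn.
  by exists id => // n; rewrite natz.
have [M BM] := additive_coordinate_controlled i vD CB.
have [[n Bn]|nB] := pselect (exists n, B (delta_mx 0 i *+ n)); last first.
  by apply: nearW => n Bn; apply: nB; exists n.
(* [n] is one position on the line inside [B]; any other position [m] in [B] satisfies
   [m - n <= M]. *)
exists (n + `|M|).+1 => // m /= nm Bm.
have := BM (_, _) (conj Bn Bm).
rewrite /= !mulmxnE !mxE !eqxx !vn => /(le_trans (ler_norm _)).
by lia.
Qed.

(** * Fixed points from the orbit along a coordinate axis *)

Theorem theorem1p3 (R : realType) (X : topologicalType)
    (CX : set (set (X * X)))
    (X_proper : proper_coarse_space CX)
    (X_connected : coarsely_connected CX)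
    (k : nat) (k_ge1 : (1 <= k)%N)
    (A : pzSemiRingType)
    (A_nat_or_int : A = nat :> pzSemiRingType \/ A = int :> pzSemiRingType)
    (act : 'rV[A]_k -> X -> X)
    (act_coarse : coarse_action CX act)
    (x0 : X)
    (orbit_coarse : coarse_map (@lattice_coarse A k) CX (fun g => act g x0)) :
  (forall (hX : topologicalType) (iota : X -> hX),
      higson_compactification R CX iota ->
      exists2 x : hX, boundary iota x &
        forall g : 'rV[A]_k, corona_image R CX CX iota iota (act g) x x)
  /\
  (forall (Xbar : topologicalType) (iota : X -> Xbar),
      coarse_compactification CX iota ->
      (forall g : 'rV[A]_k, continuous (act g)) ->
      forall actbar : 'rV[A]_k -> Xbar -> Xbar,
      is_action actbar ->
      (forall g : 'rV[A]_k, continuous (actbar g)) ->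
      (forall (g : 'rV[A]_k) (x : X), actbar g (iota x) = iota (act g x)) ->
      exists2 z : Xbar, boundary iota z &
        forall g : 'rV[A]_k, actbar g z = z).
Proof.
have [[_ actD] actC] := act_coarse; have [orb_proper orb_born] := orbit_coarse.
pose i := Ordinal k_ge1; pose s n := act (delta_mx 0 i *+ n) x0.
have s_esc B : coarse_bounded CX B -> \forall n \near \oo, ~ B (s n).
  by move=> /orb_proper; exact: lattice_line_escapes.
have s_close g : CX [set (s n, act g (s n)) | n in setT].
  have [[_ sub _ _ _] _ _ _ _] := X_proper.
  apply: sub (orb_born _ (lattice_translation A_nat_or_int g)) => _ [n _ <-].
  exists (delta_mx 0 i *+ n, delta_mx 0 i *+ n + g) => //=.
  by rewrite addrC actD.
split=> [hX iota hXP|Xbar iota XbarP _ actbar _ actbarC actbarE].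
  have [z bz sz] := escaping_cluster_boundary X_proper hXP.1 s_esc.
  exists z => // g.
  exact: corona_image_fixed X_proper X_connected hXP (actC g) s_esc (s_close g)
    bz sz.
have [z bz sz] := escaping_cluster_boundary X_proper XbarP.1 s_esc.
exists z => // g.
exact: coarse_boundary_fixed XbarP (actbarC g) (actbarE g) (s_close g) bz sz.
Qed.
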